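(* Every finite graph $G$ admits a strong $\mathbb{Q}$-emm.
   Context: Graphs may have loops and multiple edges. For a finite graph $G$ with oriented edges $e_i$, $H_1(G,\mathbb{Z})$ is its cycle group, $H^1(G,\mathbb{Z})$ its dual (cokernel of the coboundary $C^0\to\bigoplus\mathbb{Z}e_i^*$), and the image of $e_i^*$ in $H^1$ is the coedge $e_i^*$. A $\mathbb{Q}$-emm is $q\in\mathrm{Sym}^2H_1(G,\mathbb{Q})$, viewed as a quadratic form on $H^1(G,\mathbb{R})$, that is positive definite, satisfies $q(e_i^* )=1$ for every edge $e_i$ that is not a bridge, and $q(v)\ge1$ for all nonzero $v\in H^1(G,\mathbb{Z})$. It is strong if moreover $q(v)=1$ for $v\in H^1(G,\mathbb{Z})$ implies that $\pm v$ is a coedge. *)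

(* Defs.v *)
From HB Require Import structures.
From mathcomp Require Import all_boot all_order all_algebra.
From mathcomp Require Import Rstruct.
Set Implicit Arguments.
Unset Strict Implicit.
Unset Printing Implicit Defensive.
Import Order.TTheory GRing.Theory Num.Theory.
Local Open Scope ring_scope.

Section Graph.
Variables (V E : finType) (src tgt : E -> V).

Definition coboundary (K : pzRingType) (f : V -> K) : E -> K :=
  fun e => f (tgt e) - f (src e).

Definition is_coboundary (K : pzRingType) (c : E -> K) : Prop :=
  exists f : V -> K, forall e, c e = coboundary f e.

Definition cohom_eq (K : pzRingType) (c d : E -> K) : Prop :=
  is_coboundary (fun e => c e - d e).

Definition is_cycle (K : pzRingType) (c : E -> K) : Prop :=
  forall v : V, \sum_(e | tgt e == v) c e - \sum_(e | src e == v) c e = 0.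

Definition coedge (K : pzRingType) (e : E) : E -> K := fun e' => (e' == e)%:R.
Arguments coedge {K} e _.

Definition adj_without (e : E) : rel V := fun x y =>
  [exists e' : E, (e' != e) &&
     (((src e' == x) && (tgt e' == y)) || ((src e' == y) && (tgt e' == x)))].

Definition is_bridge (e : E) : bool :=
  ~~ connect (adj_without e) (src e) (tgt e).

(* Sym^2 H_1(G,Q), realised as symmetric tensors in C_1 (x) C_1 = Q^{E x E}
   whose rows (equivalently columns) are cycles. *)
Definition in_Sym2_H1 (Q : E -> E -> rat) : Prop :=
  (forall i j, Q i j = Q j i) /\ (forall i, is_cycle (Q i)).

(* the quadratic form on cochains associated with a tensor Q:
   q(v) = (v (x) v)(Q); it descends to H^1 when Q is in Sym^2 H_1 *)
Definition qform (K : comPzRingType) (Q : E -> E -> K) (v : E -> K) : K :=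
  \sum_i \sum_j Q i j * v i * v j.

Definition Qemm (Q : E -> E -> rat) : Prop :=
  [/\ in_Sym2_H1 Q,
      (forall v : E -> Rdefinitions.R, ~ is_coboundary v ->
         0 < qform (fun i j => ratr (Q i j)) v),
      (forall e : E, ~~ is_bridge e -> qform Q (coedge e) = 1) &
      (forall v : E -> int, ~ is_coboundary v ->
         1 <= qform Q (fun e => (v e)%:~R))].

Definition strong_Qemm (Q : E -> E -> rat) : Prop :=
  Qemm Q /\
  (forall v : E -> int, qform Q (fun e => (v e)%:~R) = 1 ->
     exists e : E, cohom_eq v (coedge e) \/ cohom_eq v (fun e' => - coedge e e')).

End Graph.

(* Main.v *)
Require Import Defs.
From mathcomp Require Import all_boot all_order all_algebra.
From mathcomp Require Import Rstruct.
From mathcomp Require Import boolp ring zify.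

(* Induct on the number of edges. Let T represent the nonzero coedges up to
   sign. For t in T, a strong emm q_t of G \ t pulls back along the surjection
   H^1(G) -> H^1(G \ t), whose kernel is spanned by the coedge t: it vanishes
   there, and is 1 on every other coedge because distinct coedges stay nonzero
   after deleting t. Hence q = (sum_(t in T) q_t) / (#|T| - 1) is 1 on all
   nonzero coedges and larger than 1 on every integral class that is not a
   multiple of a coedge. If #|T| <= 1, then H^1(G) has rank at most 1 and q is
   zero or the square of the unique cycle. *)

Set Implicit Arguments.
Unset Strict Implicit.
Unset Printing Implicit Defensive.
Import Order.TTheory GRing.Theory Num.Theory.
Local Open Scope ring_scope.

(** * Transversals of an equivalence relation *)

Lemma exists_transversal (E : finType) (R : E -> E -> Prop) (N : {set E}) :
  (forall e, R e e) -> (forall e f, R e f -> R f e) ->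
  (forall e f g, R e f -> R f g -> R e g) ->
  exists T : {set E},
    [/\ T \subset N, (forall e, e \in N -> exists2 t, t \in T & R e t) &
        forall t t', t \in T -> t' \in T -> R t t' -> t = t'].
Proof.
move=> Rxx Rsym Rtrans.
pose rep e := odflt e [pick f in N | `[< R e f >]].
have repP e : e \in N -> rep e \in N /\ R e (rep e).
  move=> eN; rewrite /rep; case: pickP => [f /andP[fN /asboolP Ref] //|/(_ e)].
  by rewrite eN asboolT.
(* The pick depends only on the predicate [R e], which equals [R f] for equivalent elements. The
   default value [e] is never taken on [N], where reflexivity makes the search succeed. *)
have repE e f : e \in N -> R e f -> rep e = rep f.
  move=> eN Ref; rewrite /rep.
  have -> : [pick g in N | `[< R e g >]] = [pick g in N | `[< R f g >]].
    apply: eq_pick => g /=; congr (_ && _); apply: asbool_equiv_eq; split=> ?.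
      exact: Rtrans (Rsym _ _ Ref) _.
    exact: Rtrans Ref _.
  case: pickP => [//|/(_ e)]; rewrite eN asboolT //; exact: Rsym.
exists (rep @: N); split.
- by apply/subsetP => _ /imsetP[e eN ->]; case: (repP e eN).
- by move=> e eN; exists (rep e); [apply: imset_f | case: (repP e eN)].
- move=> _ _ /imsetP[e eN ->] /imsetP[f fN ->] Rr.
  have [_ Re] := repP e eN; have [_ Rf] := repP f fN.
  by apply: repE => //; apply: Rtrans Re (Rtrans _ _ _ Rr (Rsym _ _ Rf)).
Qed.

(** * Cohomology of the subgraph with a given edge set *)

Section Emm.
Variables (V E : finType) (src tgt : E -> V).
Implicit Types (A : {set E}) (Q : E -> E -> rat).
Local Notation cob := (coboundary src tgt).

(** Equality in the first cohomology of the subgraph with all vertices and edge set [A]. Values off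
    [A] are ignored, so deleting an edge shrinks [A] and leaves the type of cochains unchanged. *)
Definition cohom_on (K : pzRingType) A (v w : E -> K) : Prop :=
  exists f : V -> K, forall e, e \in A -> v e = w e + cob f e.

Definition trivial_on (K : pzRingType) A (v : E -> K) : Prop :=
  cohom_on A v (fun=> 0).

Lemma cohom_on_trans (K : comPzRingType) A (u v w : E -> K) :
  cohom_on A u v -> cohom_on A v w -> cohom_on A u w.
Proof.
move=> [f fP] [g gP]; exists (fun x => g x + f x) => e eA.
rewrite (fP e eA) (gP e eA) /coboundary; ring.
Qed.

Lemma cohom_on_sym (K : comPzRingType) A (u v : E -> K) :
  cohom_on A u v -> cohom_on A v u.
Proof.
move=> [f fP]; exists (fun x => - f x) => e eA.
rewrite (fP e eA) /coboundary; ring.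
Qed.

Lemma cohom_on_scale (K : comPzRingType) A (c : K) (u v : E -> K) :
  cohom_on A u v -> cohom_on A (fun e => c * u e) (fun e => c * v e).
Proof.
move=> [f fP]; exists (fun x => c * f x) => e eA.
rewrite (fP e eA) /coboundary; ring.
Qed.

Lemma cohom_on_intr (K : comPzRingType) A (v w : E -> int) :
  cohom_on A v w ->
  cohom_on A (fun e => (v e)%:~R : K) (fun e => (w e)%:~R).
Proof.
move=> [f fP]; exists (fun x => (f x)%:~R) => e eA.
by rewrite (fP e eA) /coboundary rmorphD rmorphB.
Qed.

(** This computes the kernel of restriction to [A :\ t]: a potential for the restriction fails only
    at [t], and the defect there is the coefficient [c]. *)
Lemma trivial_on_del (K : comPzRingType) A t (v : E -> K) :
  trivial_on (A :\ t) v -> exists c : K, cohom_on A v (fun e => c * coedge K t e).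
Proof.
move=> [f fP]; exists (v t - cob f t), f => e eA; rewrite /coedge.
have [->|et] := eqVneq e t; first by rewrite mulr1 subrK.
by rewrite mulr0 fP // !inE et.
Qed.

(* h is the indicator of a level set of g: a cut through e that uses only edges
   on which g jumps. This is where unimodularity enters. *)
Lemma coboundary_cut (g : V -> int) e : cob g e != 0 ->
  exists h : V -> int,
    [/\ cob h e = 1, (forall x, cob g x = 0 -> cob h x = 0) &
        forall x, `|cob h x| <= 1].
Proof.
move=> ge; exists (fun v => (g v == g (tgt e))%:R); split.
- rewrite /coboundary eqxx; case: eqP => [eq_g|_]; last by rewrite subr0.
  by move: ge; rewrite /coboundary eq_g subrr eqxx.
- by move=> x /eqP; rewrite /coboundary subr_eq0 => /eqP ->; rewrite subrr.
- by move=> x; rewrite /coboundary; do 2 case: eqP.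
Qed.

(** A potential for [c] times the coedge jumps on no edge of [A] except [t], so a cut extracted from
    it meets [A] in [t] alone and has jump 1 there. *)
Lemma trivial_on_coedge A t (c : int) : t \in A -> c != 0 ->
  trivial_on A (fun e => c * coedge int t e) -> trivial_on A (coedge int t).
Proof.
move=> tA c0 [g gP].
have gt : cob g t = c by have := gP t tA; rewrite /coedge eqxx mulr1 add0r.
have [|h [h1 h0 _]] := @coboundary_cut g t; first by rewrite gt.
exists h => e eA; rewrite add0r /coedge.
have [->|et] := eqVneq e t; first by rewrite h1.
by rewrite h0 //; have := gP e eA; rewrite /coedge (negbTE et) mulr0 add0r.
Qed.

(** * Coedges up to sign *)

Definition parallel A (e f : E) : Prop :=
  exists b : bool, cohom_on A (coedge int e) (fun x => (-1) ^+ b * coedge int f x).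

Lemma parallel_refl A e : parallel A e e.
Proof.
by exists false, (fun=> 0) => x _; rewrite /coboundary expr0 mul1r subrr addr0.
Qed.

Lemma parallel_sym A e f : parallel A e f -> parallel A f e.
Proof.
move=> [b /(cohom_on_scale ((-1) ^+ b)) ef]; exists b.
apply: cohom_on_sym; apply: cohom_on_trans ef _; exists (fun=> 0) => x _.
by rewrite /coboundary mulrA -signr_addb addbb mul1r subrr addr0.
Qed.

Lemma parallel_trans A e f g : parallel A e f -> parallel A f g -> parallel A e g.
Proof.
move=> [b ef] [c /(cohom_on_scale ((-1) ^+ b)) fg]; exists (b (+) c).
apply: cohom_on_trans ef (cohom_on_trans fg _); exists (fun=> 0) => x _.
by rewrite /coboundary mulrA -signr_addb subrr addr0.
Qed.

(** Within [A] the potential [g] jumps at most on [e] and [t], so a cut through [e] stays inside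
    these two edges. Its jump at [t] is 0, 1 or -1; the value 0 would make the coedge [e] trivial,
    and the other two give the sign. *)
Lemma parallel_multiple A e t (c : int) : e \in A -> t \in A ->
  ~ trivial_on A (coedge int e) ->
  cohom_on A (coedge int e) (fun x => c * coedge int t x) -> parallel A e t.
Proof.
move=> eA tA nte [g gP].
have [->|et] := eqVneq e t; first exact: parallel_refl.
have ge : cob g e = 1.
  by have := gP e eA; rewrite /coedge eqxx (negbTE et) mulr0 add0r.
have [|h [h1 h0 hle]] := @coboundary_cut g e; first by rewrite ge.
have hP x : x \in A -> coedge int e x = - cob h t * coedge int t x + cob h x.
  move=> xA; rewrite /coedge.
  have [->|xt] := eqVneq x t; first by rewrite eq_sym (negbTE et) mulr1 addNr.
  rewrite mulr0 add0r; have [->|xe] := eqVneq x e; first by rewrite h1.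
  rewrite h0 //; have := gP x xA.
  by rewrite /coedge (negbTE xt) (negbTE xe) mulr0 add0r.
have [ht|ht|ht] : [\/ cob h t = 0, cob h t = 1 | cob h t = -1].
  have := hle t; case/boolP: (cob h t == 0) => [/eqP|]; first by constructor 1.
  case/boolP: (cob h t == 1) => [/eqP|]; first by constructor 2.
  move=> *; constructor 3; lia.
- by case: nte; exists h => x /hP ->; rewrite ht oppr0 mul0r.
- by exists true, h => x /hP ->; rewrite ht expr1.
- by exists false, h => x /hP ->; rewrite ht opprK expr0.
Qed.

(** * Cycles annihilate coboundaries *)

Lemma sum_coboundary (K : comPzRingType) (z : E -> K) (f : V -> K) :
  \sum_e z e * cob f e =
  \sum_v f v * (\sum_(e | tgt e == v) z e - \sum_(e | src e == v) z e).
Proof.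
have fiber (s : E -> V) :
    \sum_v f v * \sum_(e | s e == v) z e = \sum_e z e * f (s e).
  rewrite [RHS](partition_big s xpredT) //=; apply: eq_bigr => v _.
  by rewrite big_distrr /=; apply: eq_bigr => e /eqP ->; rewrite mulrC.
under [RHS]eq_bigr => v _ do rewrite mulrBr.
by rewrite sumrB !fiber -sumrB; apply: eq_bigr => e _; rewrite -mulrBr.
Qed.

Lemma cycle_pairing (K : comPzRingType) A (z v w : E -> K) :
  is_cycle src tgt z -> (forall e, e \notin A -> z e = 0) -> cohom_on A v w ->
  \sum_e z e * v e = \sum_e z e * w e.
Proof.
move=> zc zA [f fP].
have -> : \sum_e z e * v e = \sum_e z e * w e + \sum_e z e * cob f e.
  rewrite -big_split /=; apply: eq_bigr => e _; rewrite -mulrDr.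
  by have [/fP ->|/zA ->] := boolP (e \in A); last rewrite !mul0r.
by rewrite sum_coboundary [X in _ + X]big1 ?addr0 // => x _; rewrite zc mulr0.
Qed.

(** * Strong emms on a set of edges and their values *)

Section Form.
Variable K : realFieldType.

Definition rform Q (v : E -> K) : K := qform (fun i j => ratr (Q i j)) v.

(* The strong emm property for the subgraph with edge set A. *)
Record emm_on A Q : Prop := EmmOn {
  emm_sym : forall i j, Q i j = Q j i;
  emm_cycle : forall i, is_cycle src tgt (Q i);
  emm_supp : forall i j, j \notin A -> Q i j = 0;
  emm_pos : forall v : E -> K, ~ trivial_on A v -> 0 < rform Q v;
  emm_coedge : forall e, e \in A -> ~ trivial_on A (coedge int e) -> Q e e = 1;
  emm_int : forall v : E -> int, ~ trivial_on A v ->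
    1 <= rform Q (fun e => (v e)%:~R);
  emm_strong : forall v : E -> int, rform Q (fun e => (v e)%:~R) = 1 ->
    exists e (b : bool), cohom_on A v (fun x => (-1) ^+ b * coedge int e x)
}.

Lemma rform_cohom A Q (v w : E -> K) :
  (forall i j, Q i j = Q j i) -> (forall i, is_cycle src tgt (Q i)) ->
  (forall i j, j \notin A -> Q i j = 0) -> cohom_on A v w ->
  rform Q v = rform Q w.
Proof.
move=> Qs Qc QA vw.
have pair i : \sum_j (ratr (Q i j) : K) * v j = \sum_j ratr (Q i j) * w j.
  apply: cycle_pairing vw => [x|j /QA ->]; last by rewrite rmorph0.
  by rewrite -!(rmorph_sum (ratr : {rmorphism rat -> K})) -rmorphB Qc rmorph0.
have rformE u : rform Q u = \sum_i u i * \sum_j ratr (Q i j) * u j.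
  apply: eq_bigr => i _; rewrite big_distrr; apply: eq_bigr => j _ /=; ring.
(* One argument is changed at a time: [pair] turns both sides into the mixed value of [Q] at [v] and
   [w], and these agree by symmetry of [Q]. *)
rewrite !rformE; under eq_bigr => i _ do rewrite pair big_distrr.
rewrite exchange_big /=; under [RHS]eq_bigr => i _ do rewrite -pair big_distrr.
apply: eq_bigr => j _; apply: eq_bigr => i _; rewrite /= (Qs i j); ring.
Qed.

Lemma rform_scale Q c (v : E -> K) :
  rform Q (fun e => c * v e) = c ^+ 2 * rform Q v.
Proof.
rewrite /rform /qform big_distrr; apply: eq_bigr => i _ /=.
by rewrite big_distrr; apply: eq_bigr => j _ /=; ring.
Qed.

Lemma qform_coedge (F : comPzRingType) (Q : E -> E -> F) e :
  qform Q (coedge F e) = Q e e.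
Proof.
rewrite /qform (bigD1 e) //= (bigD1 e) //= !big1 => [|i ie|j je].
- by rewrite /coedge eqxx !mulr1 !addr0.
- by apply: big1 => j _; rewrite /coedge (negbTE ie) mulr0 mul0r.
- by rewrite /coedge (negbTE je) mulr0.
Qed.

Lemma coedge_intr (F : pzRingType) (e : E) :
  (fun x => (coedge int e x)%:~R) = coedge F e.
Proof. by apply/funext => x; rewrite /coedge; case: eqP. Qed.

Lemma rform_trivial A Q (v : E -> K) :
  emm_on A Q -> trivial_on A v -> rform Q v = 0.
Proof.
move=> QP /(rform_cohom (emm_sym QP) (emm_cycle QP) (emm_supp QP)) ->.
by apply: big1 => i _; apply: big1 => j _; rewrite mulr0.
Qed.

Lemma rform_ge0 A Q (v : E -> K) : emm_on A Q -> 0 <= rform Q v.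
Proof.
move=> QP; case: (pselect (trivial_on A v)) => [/(rform_trivial QP) -> //|].
by move/(emm_pos QP)/ltW.
Qed.

Lemma rform_line A Q t (v : E -> K) c : Q t t = 1 ->
  (forall i j, Q i j = Q j i) -> (forall i, is_cycle src tgt (Q i)) ->
  (forall i j, j \notin A -> Q i j = 0) ->
  cohom_on A v (fun x => c * coedge K t x) -> rform Q v = c ^+ 2.
Proof.
move=> Qtt Qs Qc QA /(rform_cohom Qs Qc QA) ->.
by rewrite rform_scale /rform qform_coedge Qtt rmorph1 mulr1.
Qed.

Lemma rform_int_line A Q t (v : E -> int) (c : int) : Q t t = 1 ->
  (forall i j, Q i j = Q j i) -> (forall i, is_cycle src tgt (Q i)) ->
  (forall i j, j \notin A -> Q i j = 0) ->
  cohom_on A v (fun x => c * coedge int t x) ->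
  rform Q (fun e => (v e)%:~R) = (c ^+ 2)%:~R.
Proof.
move=> Qtt Qs Qc QA /(cohom_on_intr K) vc.
rewrite rmorphXn; apply: (rform_line Qtt Qs Qc QA).
apply: cohom_on_trans vc _; exists (fun=> 0) => x _.
by rewrite -(coedge_intr K) /coboundary subrr addr0 rmorphM.
Qed.

Lemma cohom_on_line_neq0 (F : comPzRingType) A t (v : E -> F) c :
  ~ trivial_on A v -> cohom_on A v (fun x => c * coedge F t x) -> c != 0.
Proof.
move=> ntv [f fP]; apply/eqP => c0; apply: ntv; exists f => e /fP ->.
by rewrite c0 mul0r.
Qed.

(** * Cohomology of rank at most one *)

Lemma cohom_on_sum (I : finType) (F : comPzRingType) A (P : pred I) (c : I -> F)
    (u w : I -> E -> F) :
  (forall i, P i -> cohom_on A (u i) (w i)) ->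
  cohom_on A (fun x => \sum_(i | P i) c i * u i x)
             (fun x => \sum_(i | P i) c i * w i x).
Proof.
move=> uw.
have /choice[f fP] i : exists f : V -> F,
    P i -> forall e, e \in A -> u i e = w i e + cob f e.
  case: (boolP (P i)) => [/uw [f fP]|_]; first by exists f.
  by exists (fun=> 0).
exists (fun x => \sum_(i | P i) c i * f i x) => e eA.
rewrite /coboundary -sumrB -big_split /=; apply: eq_bigr => i Pi.
by rewrite fP // /coboundary; ring.
Qed.

(** Coedges generate all cochains, and integral relations among them hold over every [F]; hence a
    class [u] that generates the integral coedges generates the cohomology over [F]. *)
Lemma cohom_on_span (F : comPzRingType) A (g : E -> int) (u : E -> int) :
  (forall e, e \in A -> cohom_on A (coedge int e) (fun x => g e * u x)) ->
  forall v : E -> F,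
  cohom_on A v (fun x => (\sum_(e in A) v e * (g e)%:~R) * (u x)%:~R).
Proof.
move=> gP v.
have vg := @cohom_on_sum E F A (mem A) v _ _
  (fun e eA => cohom_on_intr F (gP e eA)).
apply: cohom_on_trans (cohom_on_trans vg _).
- exists (fun=> 0) => x xA; rewrite /coboundary subrr addr0 (bigD1 x) //=.
  rewrite big1 ?addr0 /coedge ?eqxx ?mulr1 // => e /andP[_ ex].
  by rewrite eq_sym (negbTE ex) mulr0.
- exists (fun=> 0) => x xA; rewrite /coboundary subrr addr0 big_distrl /=.
  by apply: eq_bigr => e _; rewrite rmorphM mulrA.
Qed.

Lemma emm_rank0 A : (forall e, e \in A -> trivial_on A (coedge int e)) ->
  emm_on A (fun _ _ => 0).
Proof.
move=> triv.
have triv_all (F : comPzRingType) (v : E -> F) : trivial_on A v.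
  (* The spanning lemma with generator 0 and coefficients 0. *)
  have /cohom_on_span-/(_ F v) : forall e, e \in A ->
      cohom_on A (coedge int e) (fun x => 0 * 0) by exact: triv.
  by case=> f fP; exists f => e /fP ->; rewrite mulr0.
split=> //.
- by move=> i v; rewrite !big1 ?subr0.
- by move=> v []; apply: triv_all.
- by move=> e eA []; apply: triv.
- by move=> v []; apply: triv_all.
- move=> v; rewrite /rform /qform big1 => [/eqP|i _].
    by rewrite eq_sym oner_eq0.
  by apply: big1 => j _; rewrite rmorph0 !mul0r.
Qed.

Lemma sqr_int_ge1 (c : int) : c != 0 -> 1 <= c ^+ 2.
Proof. by move=> c0; nia. Qed.

Lemma sqr_int_eq1 (c : int) : c ^+ 2 = 1 -> exists b : bool, c = (-1) ^+ b.
Proof.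
move/eqP; rewrite sqrf_eq1 => /orP[] /eqP ->; first by exists false.
by exists true.
Qed.

(** Sending each coedge to its coefficient [g e] along [t] defines a functional on cohomology, that
    is, a cycle. Its square is the form: it takes the value [c ^+ 2] on [c] times the coedge [t],
    and [g e] is a sign on nontrivial coedges. *)
Lemma emm_rank1 A t : t \in A -> ~ trivial_on A (coedge int t) ->
  (forall e, e \in A -> ~ trivial_on A (coedge int e) -> parallel A e t) ->
  exists Q, emm_on A Q.
Proof.
move=> tA ntt par.
have /choice[g gP] e : exists c : int, [/\ e \notin A -> c = 0,
    e \in A -> cohom_on A (coedge int e) (fun x => c * coedge int t x) &
    e \in A -> ~ trivial_on A (coedge int e) -> c ^+ 2 = 1].
  have [eA|eA] := boolP (e \in A); last by exists 0.
  case: (pselect (trivial_on A (coedge int e))) => [te|nte].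
    exists 0; split=> // _; case: te => f fP; exists f => x /fP ->.
    by rewrite mul0r.
  case: (par e eA nte) => b eb; exists ((-1) ^+ b); split=> // _ _.
  by rewrite sqrr_sign.
have gA e : e \notin A -> g e = 0 by case: (gP e).
have gsq e : e \in A -> ~ trivial_on A (coedge int e) -> g e ^+ 2 = 1.
  by case: (gP e).
have span (F : comPzRingType) (v : E -> F) : cohom_on A v
    (fun x => (\sum_(e in A) v e * (g e)%:~R) * coedge F t x).
  rewrite -(coedge_intr F).
  by apply: cohom_on_span => e eA; case: (gP e) => _ /(_ eA).
(* The boundary of [g] at [w] is the pairing of [g] with the coboundary of the indicator [d] of [w].
   By [span] this pairing is the coefficient along [t] of a trivial class; if it were nonzero, the
   coedge [t] would be trivial. *)
have g_cycle : is_cycle src tgt g.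
  move=> w; pose d x : int := (x == w)%:R.
  have dw (F : V -> int) : \sum_x d x * F x = F w.
    rewrite (bigD1 w) //= big1 => [|x /negbTE xw].
      by rewrite /d eqxx mul1r addr0.
    by rewrite /d xw mul0r.
  rewrite -(dw (fun x => \sum_(e | tgt e == x) g e - \sum_(e | src e == x) g e)).
  rewrite -sum_coboundary (bigID (mem A)) /= [X in _ + X]big1 ?addr0; last first.
    by move=> e /gA ->; rewrite mul0r.
  have -> : \sum_(e in A) g e * cob d e = \sum_(e in A) cob d e * (g e)%:~R.
    by apply: eq_bigr => e _; rewrite intz mulrC.
  apply/eqP/negP => /negP c0; apply: ntt; apply: trivial_on_coedge tA c0 _.
  have [f fP] := cohom_on_sym (span _ (cob d)).
  exists (fun x => f x + d x) => e eA.
  by rewrite fP // /coboundary; ring.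
pose Q i j : rat := (g i * g j)%:~R.
have Qs i j : Q i j = Q j i by rewrite /Q mulrC.
have Qc i : is_cycle src tgt (Q i).
  move=> w; rewrite /Q -!rmorph_sum -rmorphB -!mulr_sumr -mulrBr g_cycle.
  by rewrite mulr0 rmorph0.
have QA i j : j \notin A -> Q i j = 0 by move=> /gA gj; rewrite /Q gj mulr0.
have Qe e : e \in A -> ~ trivial_on A (coedge int e) -> Q e e = 1.
  by move=> eA nte; rewrite /Q -expr2 gsq.
have Qt := Qe t tA ntt.
exists Q; split=> //.
- move=> v ntv; have vc := span K v.
  rewrite (rform_line Qt Qs Qc QA vc) lt0r sqr_ge0 andbT sqrf_eq0.
  exact: cohom_on_line_neq0 ntv vc.
- move=> v ntv; have [c vc] : exists c, cohom_on A v (fun x => c * coedge int t x).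
    by eexists; apply: span.
  rewrite (rform_int_line Qt Qs Qc QA vc) -(rmorph1 intr) ler_int.
  exact: sqr_int_ge1 (cohom_on_line_neq0 ntv vc).
- move=> v; have [c vc] : exists c, cohom_on A v (fun x => c * coedge int t x).
    by eexists; apply: span.
  rewrite (rform_int_line Qt Qs Qc QA vc) => /eqP; rewrite -(rmorph1 intr) eqr_int.
  by move/eqP/sqr_int_eq1 => [b cb]; exists t, b; rewrite -cb.
Qed.

(** * Averaging over edge deletions *)

(* A class that dies in H^1(A \ t) is a multiple c of the coedge t, where the
   average takes the value c^2; any other class has all #|T| summands at
   least 1, so its average is at least #|T| / (#|T| - 1) > 1. *)
Lemma emm_average A (T : {set E}) (P : E -> E -> E -> rat) :
  T \subset A -> (forall t, t \in T -> ~ trivial_on A (coedge int t)) ->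
  (forall e, e \in A -> ~ trivial_on A (coedge int e) ->
     exists2 t, t \in T & parallel A e t) ->
  (forall t t', t \in T -> t' \in T -> parallel A t t' -> t = t') ->
  (1 < #|T|)%N -> (forall t, t \in T -> emm_on (A :\ t) (P t)) ->
  emm_on A (fun i j => #|T|.-1%:R^-1 * \sum_(t in T) P t i j).
Proof.
move=> TA ntT cover sep T2 emmP.
set k := #|T|.-1; set Q := fun i j => _.
have k0 : (0 < k)%N by rewrite /k; case: #|T| T2 => [|[]].
have kT : #|T| = k.+1 by rewrite /k prednK //; apply: leq_trans T2.
have kF (F : numFieldType) : k%:R != 0 :> F by rewrite pnatr_eq0 -lt0n.
have Qs i j : Q i j = Q j i.
  by rewrite /Q /=; congr (_ * _); apply: eq_bigr => t tT; exact: (emm_sym (emmP t tT)).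
have Qc i : is_cycle src tgt (Q i).
  move=> w; rewrite /Q -!mulr_sumr -mulrBr.
  rewrite [X in X - _]exchange_big [X in _ - X]exchange_big /= -sumrB.
  rewrite big1 ?mulr0 // => t tT; exact: (emm_cycle (emmP t tT)).
have QA i j : j \notin A -> Q i j = 0.
  move=> jA; rewrite /Q big1 ?mulr0 // => t tT.
  by apply: (emm_supp (emmP t tT)); rewrite !inE (negbTE jA) andbF.
have QE v : rform Q v = k%:R^-1 * \sum_(t in T) rform (P t) v.
  rewrite /rform /qform [in RHS]exchange_big big_distrr /=; apply: eq_bigr => i _.
  rewrite [in RHS]exchange_big big_distrr /=; apply: eq_bigr => j _.
  rewrite /Q rmorphM fmorphV rmorph_nat rmorph_sum -!mulrA; congr (_ * _).
  by rewrite big_distrl; apply: eq_bigr => t _; rewrite /= mulrA.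
have Qe e : e \in A -> ~ trivial_on A (coedge int e) -> Q e e = 1.
  move=> eA nte; have [t0 t0T et0] := cover e eA nte.
  (* Deleting the representative [t0] of [e] kills the coedge [e]. If deleting [t] kills it, then it
     is a multiple of the coedge [t], so [e] is parallel to [t] and [t = t0] by [sep]. *)
  have Pe t : t \in T -> P t e e = (t != t0)%:R.
    move=> tT; have [->|tt0] /= := eqVneq t t0.
      have tre : trivial_on (A :\ t0) (coedge int e).
        have [b [f fP]] := et0; exists f => x; rewrite !inE => /andP[xt xA].
        by rewrite fP // /coedge (negbTE xt) mulr0.
      have := rform_trivial (emmP t0 t0T) (cohom_on_intr K tre).
      by rewrite coedge_intr /rform qform_coedge => /eqP; rewrite fmorph_eq0 => /eqP.
    have nt_of : ~ trivial_on (A :\ t) (coedge int e).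
      move=> /trivial_on_del [c] /(parallel_multiple eA (subsetP TA t tT) nte) et.
      case/eqP: tt0; apply: sep => //.
      exact: parallel_trans (parallel_sym et) et0.
    apply: (emm_coedge (emmP t tT)) => //; rewrite !inE eA andbT.
    apply/eqP => te; apply: nt_of; exists (fun=> 0) => x; rewrite !inE te.
    by move=> /andP[/negbTE xt _]; rewrite /coedge xt.
  (* All summands but the one at [t0] equal 1, so the sum is [k]; this fixes the normalisation. *)
  rewrite /Q (eq_bigr _ Pe) (bigD1 t0) //= eqxx add0r.
  rewrite (eq_bigr (fun=> 1)) => [|t /andP[_ ->]] //.
  have /eqP := cardD1 t0 T; rewrite t0T kT add1n eqSS => /eqP kE.
  rewrite sumr_const (_ : #|_| = k) ?mulVf ?kF // kE.
  by apply: eq_card => x; rewrite !inE andbC.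
have QT t (tT : t \in T) : Q t t = 1 := Qe t (subsetP TA t tT) (ntT t tT).
have dichotomy (F : comPzRingType) (v : E -> F) :
    (exists t c, t \in T /\ cohom_on A v (fun x => c * coedge F t x)) \/
    (forall t, t \in T -> ~ trivial_on (A :\ t) v).
  case: (pselect (exists2 t, t \in T & trivial_on (A :\ t) v)).
    by move=> [t tT /trivial_on_del [c vc]]; left; exists t, c.
  by move=> nex; right => t tT triv; apply: nex; exists t.
have large (v : E -> int) : (forall t, t \in T -> ~ trivial_on (A :\ t) v) ->
    1 < rform Q (fun e => (v e)%:~R).
  move=> ntv; rewrite QE mulrC ltr_pdivlMr ?ltr0n // mul1r.
  apply: (@lt_le_trans _ _ (#|T|%:R)); first by rewrite kT ltr_nat.
  rewrite -sumr_const; apply: ler_sum => t tT.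
  exact: (emm_int (emmP t tT)) (ntv t tT).
split=> //.
- move=> v ntv; case: (dichotomy K v) => [[t [c [tT vc]]]|ntvT].
    rewrite (rform_line (QT t tT) Qs Qc QA vc) lt0r sqr_ge0 andbT sqrf_eq0.
    exact: cohom_on_line_neq0 ntv vc.
  rewrite QE mulr_gt0 ?invr_gt0 ?ltr0n //.
  have [t tT] : exists t, t \in T by apply/card_gt0P; rewrite kT.
  rewrite (bigD1 t) //= ltr_pwDl //; first exact: (emm_pos (emmP t tT)) (ntvT t tT).
  by apply: sumr_ge0 => s /andP[sT _]; apply: rform_ge0 (emmP s sT).
- move=> v ntv; case: (dichotomy int v) => [[t [c [tT vc]]]|/large /ltW //].
  rewrite (rform_int_line (QT t tT) Qs Qc QA vc) -(rmorph1 intr) ler_int.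
  exact: sqr_int_ge1 (cohom_on_line_neq0 ntv vc).
- move=> v; case: (dichotomy int v) => [[t [c [tT vc]]]|/large Q1 eq1].
    rewrite (rform_int_line (QT t tT) Qs Qc QA vc) => /eqP.
    rewrite -(rmorph1 intr) eqr_int => /eqP/sqr_int_eq1 [b cb].
    by exists t, b; rewrite -cb.
  by move: Q1; rewrite eq1 ltxx.
Qed.

(** * Induction on the number of edges *)

Lemma exists_emm_on A : exists Q, emm_on A Q.
Proof.
have [n] := ubnP #|A|; elim: n A => // n IH A leA.
pose N := [set e in A | ~~ `[< trivial_on A (coedge int e) >]].
have NP e : reflect (e \in A /\ ~ trivial_on A (coedge int e)) (e \in N).
  by rewrite inE; apply: (iffP andP) => -[eA /asboolPn].
have [T [TN cover sep]] := exists_transversal N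
  (@parallel_refl A) (@parallel_sym A) (@parallel_trans A).
have TP t : t \in T -> t \in A /\ ~ trivial_on A (coedge int t).
  by move=> /(subsetP TN)/NP.
have coverA e : e \in A -> ~ trivial_on A (coedge int e) ->
    exists2 t, t \in T & parallel A e t.
  by move=> eA nte; apply: cover; apply/NP.
have [T2|] := ltnP 1 #|T|.
  have /choice[P PP] t : exists Q, t \in T -> emm_on (A :\ t) Q.
    have [/TP[tA _]|_] := boolP (t \in T); last by exists (fun _ _ => 0).
    have [|Q QP] := IH (A :\ t); last by exists Q.
    by rewrite (cardsD1 t A) tA in leA.
  exists (fun i j => #|T|.-1%:R^-1 * \sum_(t in T) P t i j).
  apply: emm_average => // [|t /TP[] //].
  by apply/subsetP => t /TP[].
(* With at most one class of nontrivial coedges, the rank is 0 or 1. *)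
case: (set_0Vmem T) => [T0 _|[t tT] T1].
  exists (fun _ _ => 0); apply: emm_rank0 => e eA; apply: contrapT => nte.
  by have [t] := coverA e eA nte; rewrite T0 inE.
have [tA ntt] := TP t tT; apply: emm_rank1 tA ntt _ => e eA nte.
have [t' t'T] := coverA e eA nte.
by have /card_le1_eqP/(_ t' t) -> := T1.
Qed.

End Form.

(** * Bridges and passage to the whole graph *)

Lemma is_bridge_trivial e : is_coboundary src tgt (coedge int e) ->
  is_bridge src tgt e.
Proof.
move=> [f fP]; apply/negP => /connectP [p pP lastp].
(* The potential [f] jumps only across [e], so it is constant along a path avoiding [e]; such a path
   between the ends of [e] contradicts the jump 1 there. *)
have fconst : forall x, path (adj_without src tgt e) x p -> f (last x p) = f x.
  elim: p {pP lastp} => //= y p IH x /andP[/existsP[e' /andP[e'e adj]] /IH ->].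
  have /eqP := fP e'; rewrite /coedge (negbTE e'e) eq_sym subr_eq0.
  by case/orP: adj => /andP[/eqP <- /eqP <-] /eqP.
have := fP e.
by rewrite /coedge /coboundary eqxx lastp (fconst _ pP) subrr => /eqP; rewrite oner_eq0.
Qed.

End Emm.

(** Transfers the integral conditions from [K], where [emm_on] states them, to the rationals, where
    [Qemm] and [strong_Qemm] do. *)
Lemma rform_ratr (E : finType) (K : realFieldType) (Q : E -> E -> rat)
    (v : E -> int) :
  rform Q (fun e => (v e)%:~R : K) = ratr (qform Q (fun e => (v e)%:~R)).
Proof.
rewrite /rform /qform rmorph_sum; apply: eq_bigr => i _.
by rewrite rmorph_sum; apply: eq_bigr => j _; rewrite !rmorphM /= !ratr_int.
Qed.

Theorem theorem5p6 (V E : finType) (src tgt : E -> V) :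
  exists Q : E -> E -> rat, strong_Qemm src tgt Q.
Proof.
have [Q QP] := @exists_emm_on V E src tgt Rdefinitions.R [set: E].
have cobT (K : pzRingType) (v : E -> K) :
    is_coboundary src tgt v <-> trivial_on src tgt [set: E] v.
  by split=> -[f fP]; exists f => e; [rewrite add0r|rewrite fP ?inE ?add0r].
exists Q; split; first split.
- by split; [apply: emm_sym QP | apply: emm_cycle QP].
- by move=> v nv; apply: (emm_pos QP) => /cobT.
- move=> e nb.
  rewrite qform_coedge; apply: (emm_coedge QP) => [|/cobT/is_bridge_trivial].
    by rewrite inE.
  by rewrite (negbTE nb).
- move=> v nv; have : 1 <= rform Q (fun e => (v e)%:~R : Rdefinitions.R).
    by apply: (emm_int QP) => /cobT.
  by rewrite rform_ratr -(rmorph1 ratr) ler_rat.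
- move=> v q1; have [|e [b [f fP]]] := emm_strong QP (v := v).
    by rewrite rform_ratr q1 rmorph1.
  exists e; case: b fP => fP; [right|left]; exists f => x.
    by rewrite fP ?inE // expr1; ring.
  by rewrite fP ?inE // expr0; ring.
Qed.
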